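(* Let $1\le p<\infty$ and $\varepsilon\le n^{-\frac1p-\delta}$ with $\delta>0$. There exist a (finite) family $\mathcal{F}$ of convex functions on the $n$-dimensional unit $L^p$-ball $B_p(0,1)=\{x\in\mathbb{R}^n:\|x\|_p\le 1\}$ that are Lipschitz-continuous in the $L^p$ norm with Lipschitz constant $1$, and a single-coordinate oracle for $\mathcal{F}$, such that both the distributional and the high-probability oracle complexity of finding an $\varepsilon$-minimum under the uniform distribution on $\mathcal F$ are $\Omega\left(n\log\frac1\varepsilon\right)$. For algorithms with error probability at most $P_e$, the distributional complexity is $\Omega\left((1-P_e)\,n\log\frac1\varepsilon\right)$ and the high-probability complexity is $\Omega\left(n\log\frac1\varepsilon\right)$.
   Context: The family and the oracle may depend on $n,\varepsilon,p$. $\log$ is the binary logarithm. For $f:X\to\mathbb{R}$ with $f^*=\min_X f$, an $\varepsilon$-minimum is a point $x\in X$ with $f(x)<f^*+\varepsilon$. A first-order oracle for a family $\mathcal{F}$ of functions on $X$ answers a query $x\in X$ on instance $f$ by $(f(x),g)$ with $g\in\partial f(x)$ a subgradient. It is single-coordinate if for all $x$ the returned subgradient has the form $\lambda e_i$ ($\lambda\in\mathbb{R}$, $e_i$ the $i$-th standard coordinate vector) with $i$ the smallest index for which a subgradient of $f$ at $x$ of this form exists. An algorithm knows $\mathcal{F}$ and the instance distribution but accesses the instance only by adaptive oracle queries; it stops and outputs a point of $X$. $T$ denotes its number of queries. The error probability is at most $P_e$ if the output is an $\varepsilon$-minimum with probability at least $1-P_e$ (over the random instance and any private randomness); $P_e=0$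 if no error is mentioned. The asymptotic statements mean: there is a constant $c>0$ (depending at most on $p$ and $\delta$) such that every algorithm with error probability at most $P_e$ satisfies $\mathbb{E}[T]\ge c(1-P_e)n\log\frac1\varepsilon$ (distributional) and $\mathbb{P}[T\ge c\,n\log\frac1\varepsilon]\ge1-P_e-o(1)$ (high-probability), asymptotically as $n\to\infty$ within the stated range of $\varepsilon$, with $p$, $\delta$ and $P_e\in[0,1)$ fixed. *)

(* Defs.v *)
From HB Require Import structures.
From mathcomp Require Export all_boot all_order all_algebra.
From mathcomp Require Export all_classical all_reals all_analysis.
From mathcomp Require Export measurable_realfun.

Set Implicit Arguments.
Unset Strict Implicit.
Unset Printing Implicit Defensive.

Import Order.TTheory GRing.Theory Num.Theory.
Import numFieldNormedType.Exports.

Local Open Scope classical_set_scope.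
Local Open Scope ring_scope.

Definition log2 (R : realType) (x : R) : R := ln x / ln 2.

Definition lp_norm (R : realType) (p : R) (n : nat) (x : 'rV[R]_n) : R :=
  (\sum_(i < n) `|x 0 i| `^ p) `^ p^-1.

Definition lp_ball (R : realType) (p : R) (n : nat) : set 'rV[R]_n :=
  [set x | lp_norm p x <= 1].
Arguments lp_ball {R} p {n}.

Definition lp_lipschitz1 (R : realType) (p : R) (n : nat) (X : set 'rV[R]_n)
    (f : 'rV[R]_n -> R) : Prop :=
  forall x y, X x -> X y -> `|f x - f y| <= lp_norm p (x - y).

(* Functions on X are represented by total functions whose values outside X
   are irrelevant; accordingly the subdifferential is that of f : X -> R, i.e.,
   the subgradient inequality is only required against the points of X. *)
Definition subgradient (R : realType) (n : nat) (X : set 'rV[R]_n)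
    (f : 'rV[R]_n -> R) (x g : 'rV[R]_n) : Prop :=
  forall y, X y -> f x + \sum_(i < n) g 0 i * (y 0 i - x 0 i) <= f y.

Definition eps_minimum (R : realType) (n : nat) (X : set 'rV[R]_n)
    (f : 'rV[R]_n -> R) (eps : R) (x : 'rV[R]_n) : Prop :=
  X x /\ exists xmin, [/\ X xmin, forall y, X y -> f xmin <= f y
                        & f x < f xmin + eps].

Record family (R : realType) (n : nat) := Family {
  instance : finType;
  objective : instance -> 'rV[R]_n -> R }.

(* The indexing has no repetition, so that the uniform distribution on the
   indices is the uniform distribution on the set of functions X -> R. *)
Definition convex_lipschitz_family (R : realType) (p : R) (n : nat)
    (X : set 'rV[R]_n) (F : family R n) : Prop :=
  [/\ (0 < #|instance F|)%N,
      forall i j : instance F,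
        (forall x, X x -> objective i x = objective j x) -> i = j,
      forall i : instance F, convex_function X (objective i)
    & forall i : instance F, lp_lipschitz1 p X (objective i)].

Definition answer (R : realType) (n : nat) : Type := (R * 'rV[R]_n)%type.

Definition oracle (R : realType) (n : nat) (F : family R n) : Type :=
  instance F -> 'rV[R]_n -> answer R n.

Definition first_order (R : realType) (n : nat) (X : set 'rV[R]_n)
    (F : family R n) (O : oracle F) : Prop :=
  forall (i : instance F) x, X x ->
    (O i x).1 = objective i x /\ subgradient X (objective i) x (O i x).2.

Definition single_coordinate (R : realType) (n : nat) (X : set 'rV[R]_n)
    (F : family R n) (O : oracle F) : Prop :=
  forall (i : instance F) x, X x ->
    exists (k : 'I_n) (lambda : R),
      (O i x).2 = lambda *: delta_mx 0 k /\
      forall (j : 'I_n) (mu : R), (j < k)%N ->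
        ~ subgradient X (objective i) x (mu *: delta_mx 0 j).

Inductive action (R : realType) (n : nat) : Type :=
  | Query of 'rV[R]_n
  | Output of 'rV[R]_n.

(* What a deterministic algorithm does next, given the answers received so far
   (in chronological order); the earlier queries are determined by the earlier
   answers. *)
Definition strategy (R : realType) (n : nat) : Type :=
  seq (answer R n) -> action R n.

Fixpoint history (R : realType) (n : nat) (A : strategy R n)
    (O : 'rV[R]_n -> answer R n) (t : nat) : seq (answer R n) :=
  if t is t'.+1 then
    let h := history A O t' in
    if A h is Query x then rcons h (O x) else h
  else [::].

Definition outputs (R : realType) (n : nat) (A : strategy R n)
    (O : 'rV[R]_n -> answer R n) (x : 'rV[R]_n) : Prop :=
  exists t, A (history A O t) = Output x.

(* The history stops growing at the output; the value is +oo if there is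
   no output. *)
Definition num_queries (R : realType) (n : nat) (A : strategy R n)
    (O : 'rV[R]_n -> answer R n) : \bar R :=
  ereal_sup [set ((size (history A O t))%:R : R)%:E | t in [set: nat]].

Definition success (R : realType) (n : nat) (X : set 'rV[R]_n) (F : family R n)
    (O : oracle F) (eps : R) (A : strategy R n) (i : instance F) : Prop :=
  exists x, outputs A (O i) x /\ eps_minimum X (objective i) eps x.

(* A randomized algorithm is a random strategy A w, w being the private
   randomness, drawn independently of the instance. *)
Definition algorithm (R : realType) (n : nat) (X : set 'rV[R]_n)
    (F : family R n) (O : oracle F) (eps : R)
    (d : measure_display) (W : measurableType d) (P : probability W R)
    (A : W -> strategy R n) : Prop :=
  [/\ forall w h, match A w h with Query x => X x | Output x => X x end,
      forall i : instance F, {ae P, forall w, exists x, outputs (A w) (O i) x},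
      forall i : instance F,
        measurable_fun [set: W] (fun w => num_queries (A w) (O i))
    & forall i : instance F,
        measurable [set w | success X O eps (A w) i]].

Definition uniform_mean (R : realType) (I : finType) (g : I -> \bar R) : \bar R :=
  (((#|I|%:R : R)^-1)%:E * \sum_(i : I) g i)%E.

Definition success_probability (R : realType) (n : nat) (X : set 'rV[R]_n)
    (F : family R n) (O : oracle F) (eps : R)
    (d : measure_display) (W : measurableType d) (P : probability W R)
    (A : W -> strategy R n) : \bar R :=
  uniform_mean (fun i : instance F => P [set w | success X O eps (A w) i]).

Definition expected_queries (R : realType) (n : nat)
    (F : family R n) (O : oracle F)
    (d : measure_display) (W : measurableType d) (P : probability W R)
    (A : W -> strategy R n) : \bar R :=
  uniform_mean (fun i : instance F => \int[P]_w num_queries (A w) (O i))%E.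

Definition queries_tail (R : realType) (n : nat)
    (F : family R n) (O : oracle F)
    (d : measure_display) (W : measurableType d) (P : probability W R)
    (A : W -> strategy R n) (a : R) : \bar R :=
  uniform_mean
    (fun i : instance F => P [set w | (a%:E <= num_queries (A w) (O i))%E]).

Definition low_scale (R : realType) (p delta : R) (n : nat) (eps : R) : Prop :=
  0 < eps /\ eps <= n%:R `^ (- p^-1 - delta).

Definition distributional_lower_bound (R : realType) (p delta : R)
    (F : forall n : nat, R -> family R n)
    (O : forall (n : nat) (eps : R), oracle (F n eps)) (c Pe : R) : Prop :=
  exists N : nat, forall (n : nat) (eps : R),
    (N <= n)%N -> low_scale p delta n eps ->
    forall (d : measure_display) (W : measurableType d) (P : probability W R)
      (A : W -> strategy R n),
      algorithm (lp_ball p) (O n eps) eps P A ->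
      ((1 - Pe)%:E <= success_probability (lp_ball p) (O n eps) eps P A)%E ->
      ((c * (1 - Pe) * n%:R * log2 eps^-1)%:E
         <= expected_queries (O n eps) P A)%E.

Definition high_probability_lower_bound (R : realType) (p delta : R)
    (F : forall n : nat, R -> family R n)
    (O : forall (n : nat) (eps : R), oracle (F n eps)) (c Pe : R) : Prop :=
  exists2 r : nat -> R, r @ \oo --> (0 : R) &
  exists N : nat, forall (n : nat) (eps : R),
    (N <= n)%N -> low_scale p delta n eps ->
    forall (d : measure_display) (W : measurableType d) (P : probability W R)
      (A : W -> strategy R n),
      algorithm (lp_ball p) (O n eps) eps P A ->
      ((1 - Pe)%:E <= success_probability (lp_ball p) (O n eps) eps P A)%E ->
      ((1 - Pe - r n)%:E
         <= queries_tail (O n eps) P A (c * n%:R * log2 eps^-1))%E.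

(* Main.v *)
(* In dimension one, a bit string [s] encodes a nested family of convex functions:
   inside the interval [-1, 1] the absolute value is replaced by the maximum of
   itself and a 1/16-scaled copy of the function of the tail of [s], centred at
   1/4 or -1/4 according to the first bit. All these functions have the same
   minimum, and approximate minimizers of two of them to accuracy about [16^-M]
   are disjoint. Whatever prefix of [s] is known, at each point one value of the
   next bit forces the largest value still possible there, and then determines
   the answer of the oracle.

   The hard functions are the maxima of [n] such functions of the coordinates,
   scaled to the cube of radius [n^(-1/p)] inside the unit ball. A query thus
   tests unknown bits one after the other until the first bad one: an algorithm
   identifies within [t] queries at most as many of the [2^(nM)] instances as
   there are sets of at most [t] bad bits among [nM]. For [t <= nM/4] this is an
   exponentially small fraction. Finally [M] is of order [log (1/eps)] since
   [eps <= n^(-1/p-delta)]. *)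

Require Import Defs.
From mathcomp Require Import ring lra zify.
Set Implicit Arguments.
Unset Strict Implicit.
Unset Printing Implicit Defensive.
Import Order.TTheory GRing.Theory Num.Theory.
Import numFieldNormedType.Exports.
Local Open Scope ring_scope.

(** * One-dimensional functions *)

Definition bsign (R : realType) (b : bool) : R := if b then -1 else 1.

Fixpoint zigzag (R : realType) (s : seq bool) (x : R) : R :=
  if s is b :: s' then Num.max `|x| (1 / 2 + zigzag s' (4 * x - bsign R b) / 16)
  else `|x|.

(** The tail is scaled by 1/16 in value and by 4 in its argument, whence the factor 1/4. *)
Fixpoint zigzag_slope (R : realType) (s : seq bool) (x : R) : R :=
  if s is b :: s' then
    if 1 / 2 + zigzag s' (4 * x - bsign R b) / 16 <= `|x| then Num.sg x
    else zigzag_slope s' (4 * x - bsign R b) / 4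
  else Num.sg x.

Fixpoint zigzag_argmin (R : realType) (s : seq bool) : R :=
  if s is b :: s' then (zigzag_argmin R s' + bsign R b) / 4 else 0.

Fixpoint zigzag_min (R : realType) (m : nat) : R :=
  if m is m'.+1 then 1 / 2 + zigzag_min R m' / 16 else 0.

(* Largest value at [x] among the zigzags whose code extends [u]; a tail starting
   with the bit pointing away from [x] contributes
   [1 / 2 + (4 * `|x| + 1) / 16 = 9 / 16 + `|x| / 4]. *)
Fixpoint zigzag_cap (R : realType) (u : seq bool) (x : R) : R :=
  if u is b :: u' then Num.max `|x| (1 / 2 + zigzag_cap u' (4 * x - bsign R b) / 16)
  else Num.max `|x| (9 / 16 + `|x| / 4).

Section Zigzag.
Variable R : realType.
Implicit Types (x y : R) (s u : seq bool) (b : bool) (m : nat).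

Lemma normr_bsign b : `|bsign R b| = 1.
Proof. by case: b; rewrite /= ?normrN normr1. Qed.

Lemma ler_norm_affine_bsign x b : `|4 * x - bsign R b| <= 4 * `|x| + 1.
Proof.
rewrite (le_trans (ler_normB _ _))// normr_bsign normrM ger0_norm//.
Qed.

Lemma zigzag_ge_norm s x : `|x| <= zigzag s x.
Proof. by case: s => [|b s]//=; rewrite le_max lexx. Qed.

(** For [|x| <= 1] the scaled copy is at most 1/2 + 5/16 < 1; farther out it is at most 9/16 + |x|/4
    <= |x|. So the bits matter only inside [-1, 1]. *)
Lemma zigzag_le s x : zigzag s x <= Num.max 1 `|x|.
Proof.
elim: s x => [|b s IH] x /=; first by rewrite le_max lexx orbT.
rewrite ge_max le_max lexx orbT /=.
have := ler_norm_affine_bsign x b.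
have := IH (4 * x - bsign R b); rewrite !le_max.
have := normr_ge0 x.
move=> x0 /orP[h _|h h']; have [x1|x1] := leP `|x| 1; apply/orP;
  [left|right|left|right]; lra.
Qed.

Lemma zigzag_out s x : 1 <= `|x| -> zigzag s x = `|x|.
Proof.
move=> x1; apply/eqP; rewrite eq_le zigzag_ge_norm andbT.
by rewrite (le_trans (zigzag_le s x))// ge_max x1 lexx.
Qed.

Lemma zigzag_min_bounds m : 0 <= zigzag_min R m <= 3 / 4.
Proof. by elim: m => [|m /andP[? ?]] /=; apply/andP; split; lra. Qed.

Lemma zigzag_ge_min s x : zigzag_min R (size s) <= zigzag s x.
Proof.
elim: s x => [|b s IH] x //=.
rewrite le_max; apply/orP; right.
by have := IH (4 * x - bsign R b); lra.
Qed.

(** The bound equals the additive constant 1/2 in [zigzag], so the outer absolute value never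
    dominates at this point. *)
Lemma zigzag_argmin_bound s : `|zigzag_argmin R s| <= 1 / 2.
Proof.
elim: s => [|b s IH] /=; first by rewrite normr0; lra.
rewrite normrM (ger0_norm (_ : 0 <= 4^-1))//.
have := ler_normD (zigzag_argmin R s) (bsign R b).
by rewrite normr_bsign; lra.
Qed.

Lemma zigzag_argminE s : zigzag s (zigzag_argmin R s) = zigzag_min R (size s).
Proof.
elim: s => [|b s IH] /=; first by rewrite normr0.
rewrite (_ : 4 * _ - _ = zigzag_argmin R s); last by field.
rewrite IH; apply/max_idPr.
have /= := zigzag_argmin_bound (b :: s).
have /andP[+ _] := zigzag_min_bounds (size s).
by lra.
Qed.

Lemma zigzag_convex s x y (t : R) : 0 <= t <= 1 ->
  zigzag s (t * x + (1 - t) * y) <= t * zigzag s x + (1 - t) * zigzag s y.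
Proof.
move=> /andP[t0 t1]; elim: s x y => [|b s IH] x y /=.
  rewrite (le_trans (ler_normD _ _))// !normrM (ger0_norm t0).
  by rewrite (ger0_norm (_ : 0 <= 1 - t)) ?subr_ge0.
have u0 : 0 <= 1 - t by rewrite subr_ge0.
rewrite ge_max; apply/andP; split.
  rewrite (le_trans (ler_normD _ _))// !normrM (ger0_norm t0) (ger0_norm u0).
  by apply: lerD; apply: ler_wpM2l => //; rewrite le_max lexx.
have := IH (4 * x - bsign R b) (4 * y - bsign R b).
rewrite (_ : t * _ + _ = 4 * (t * x + (1 - t) * y) - bsign R b); last by ring.
set zx := zigzag s (4 * x - _); set zy := zigzag s (4 * y - _) => h.
have hx : t * (1 / 2 + zx / 16) <= t * Num.max `|x| (1 / 2 + zx / 16).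
  by apply: ler_wpM2l => //; rewrite le_max lexx orbT.
have hy : (1 - t) * (1 / 2 + zy / 16) <= (1 - t) * Num.max `|y| (1 / 2 + zy / 16).
  by apply: ler_wpM2l => //; rewrite le_max lexx orbT.
by apply: le_trans (lerD hx hy); lra.
Qed.

Lemma zigzag_le_shift s x y : zigzag s x <= zigzag s y + `|x - y|.
Proof.
elim: s x y => [|b s IH] x y /=.
  by rewrite -lerBlDl (le_trans (lerB_dist _ _)).
rewrite ge_max; apply/andP; split.
  rewrite -lerBlDr; apply: (@le_trans _ _ `|y|); last by rewrite le_max lexx.
  by have := lerB_dist x y; lra.
have := IH (4 * x - bsign R b) (4 * y - bsign R b).
rewrite (_ : 4 * x - _ - _ = 4 * (x - y)); last by ring.
rewrite normrM (ger0_norm (_ : 0 <= 4))//.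
set zx := zigzag s (4 * x - _); set zy := zigzag s (4 * y - _) => h.
have hy : 1 / 2 + zy / 16 <= Num.max `|y| (1 / 2 + zy / 16).
  by rewrite le_max lexx orbT.
by have := normr_ge0 (x - y); lra.
Qed.

Lemma zigzag_subgradient s x y :
  zigzag s x + zigzag_slope s x * (y - x) <= zigzag s y.
Proof.
have norm_sub (x' y' : R) : `|x'| + Num.sg x' * (y' - x') <= `|y'|.
  have := ler_norm y'; have := lerNnormlW (lexx `|y'|).
  by case: sgrP => x0; rewrite ?mul0r; have := normr_ge0 y'; lra.
elim: s x y => [|b s IH] x y /=; first exact: norm_sub.
rewrite le_max; case: ifPn => [h|].
  by rewrite (max_idPl h) norm_sub.
rewrite -ltNge => /ltW h; rewrite (max_idPr h); apply/orP; right.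
have := IH (4 * x - bsign R b) (4 * y - bsign R b).
rewrite (_ : 4 * y - _ - _ = 4 * (y - x)); last by ring.
by lra.
Qed.

(** Equal first bits are stripped, which multiplies the gap by 16. If they differ, both tails have a
    value below 3/4 + 1/4 = 1, one at 4x - 1 and one at 4x + 1; but these points are at distance 2,
    so one of them has absolute value at least 1. *)
Lemma zigzag_sep s s' x : size s = size s' ->
  zigzag s x < zigzag_min R (size s) + 16^-1 ^+ (size s) / 4 ->
  zigzag s' x < zigzag_min R (size s) + 16^-1 ^+ (size s) / 4 ->
  s = s'.
Proof.
elim: s s' x => [|b s IH] [|b' s'] x //= [ss].
have /andP[_ v1] := zigzag_min_bounds (size s).
have e1 : (16^-1 : R) ^+ size s <= 1.
  by rewrite exprn_ile1// ?invr_ge0// invf_le1//; lra.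
rewrite exprS !gt_max => /andP[_ h] /andP[_ h'].
have [bb'|bb'] := eqVneq b b'.
  by rewrite -bb' in h' *; congr cons; apply: (IH s' (4 * x - bsign R b)) => //; lra.
have z := zigzag_ge_norm s (4 * x - bsign R b).
have z' := zigzag_ge_norm s' (4 * x - bsign R b').
have y := ler_norm (4 * x + 1); have y' := lerNnormlW (lexx `|4 * x - 1|).
by exfalso; move: bb' h h' z z'; case: b; case: b' => //= _; rewrite opprK; lra.
Qed.

Lemma zigzag_le_cap u s x : zigzag (u ++ s) x <= zigzag_cap u x.
Proof.
elim: u x => [|b u IH] x /=; last first.
  rewrite ge_max !le_max lexx /=; apply/orP; right.
  by have := IH (4 * x - bsign R b); lra.
case: s => [|b s] /=; first by rewrite le_max lexx.
rewrite ge_max !le_max lexx /=; apply/orP; right.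
have := zigzag_le s (4 * x - bsign R b); rewrite le_max.
have := ler_norm_affine_bsign x b.
by have := normr_ge0 x => ? ? /orP[]; lra.
Qed.

(* The bit pointing away from [x] puts [x] where the rescaled tail function is
   the absolute value, so this bit alone determines the answer at [x], and it
   yields the largest possible value. *)
Lemma zigzag_cap_attained u x : exists b c, forall s,
  zigzag (u ++ b :: s) x = zigzag_cap u x /\ zigzag_slope (u ++ b :: s) x = c.
Proof.
elim: u x => [|b u IH] x /=; last first.
  have [b' [c h]] := IH (4 * x - bsign R b).
  exists b', (if 1 / 2 + zigzag_cap u (4 * x - bsign R b) / 16 <= `|x|
              then Num.sg x else c / 4) => s.
  by have [-> ->] := h s.
(* As [true] stands for the sign -1, this bit shifts 4x away from 0, to absolute value 4|x| + 1. *)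
pose b := 0 <= x.
have yE : `|4 * x - bsign R b| = 4 * `|x| + 1.
  rewrite /b; case: (lerP 0 x) => x0 /=.
    by rewrite opprK !ger0_norm//; lra.
  by rewrite !ltr0_norm//; lra.
have y1 : 1 <= `|4 * x - bsign R b| by rewrite yE; have := normr_ge0 x; lra.
have sE s : zigzag_slope s (4 * x - bsign R b) = Num.sg (4 * x - bsign R b).
  case: s => [|c s] //=; rewrite ifT//.
  rewrite -[leRHS](zigzag_out (c :: s) y1) /= le_max lexx orbT//.
exists b, (if 9 / 16 + `|x| / 4 <= `|x| then Num.sg x
           else Num.sg (4 * x - bsign R b) / 4) => s.
rewrite zigzag_out// yE sE (_ : 1 / 2 + _ = 9 / 16 + `|x| / 4)//; lra.
Qed.

End Zigzag.

(** * Decision trees *)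

(** The run is unfolded from its first query: after the answer [O x] the rest of the algorithm is
    again a strategy, to which an induction on the query budget applies. *)
Fixpoint solved_within (R : realType) (n : nat) (O : 'rV[R]_n -> answer R n)
    (good : pred 'rV[R]_n) (t : nat) (A : strategy R n) : bool :=
  match A [::] with
  | Output x => good x
  | Query x =>
      if t is t'.+1 then solved_within O good t' (fun h => A (O x :: h)) else false
  end.

Section Runs.
Variables (R : realType) (n : nat) (O : 'rV[R]_n -> answer R n).
Implicit Types (A : strategy R n) (t : nat).

(** [history] grows at its end while [solved_within] consumes the first answer; this reconciles the
    two. *)
Lemma history_query A x t : A [::] = Query x ->
  history A O t.+1 = O x :: history (fun h => A (O x :: h)) O t.
Proof.
move=> Ax; elim: t => [|t IH]; first by rewrite /= Ax.
by rewrite [LHS]/= -/(history A O t.+1) IH /=; case: (A _).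
Qed.

Lemma history_output A x t : A [::] = Output x -> history A O t = [::].
Proof. by move=> Ax; elim: t => //= t ->; rewrite Ax. Qed.

Lemma solved_within_history (good : pred 'rV[R]_n) A x t0 t :
  A (history A O t0) = Output x -> (size (history A O t0) <= t)%N ->
  good x -> solved_within O good t A.
Proof.
elim: t0 t A => [|t0 IH] t A; first by case: t => [|t] /= ->.
case E : (A [::]) => [y|y].
  rewrite (history_query _ E) /=; case: t => //= t h st gx.
  by rewrite E; exact: IH h st gx.
by rewrite (history_output _ E) E => -[<-] _; case: t => [|t] /=; rewrite E.
Qed.

End Runs.

Section GuessingGame.
Variables (R : realType) (n : nat) (S : finType) (ans : S -> 'rV[R]_n -> answer R n).
Variables (good : S -> pred 'rV[R]_n) (state : Type).
Variables (cell : state -> {set S}) (entropy : state -> nat).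

Definition answer_constant (V : {set S}) (x : 'rV[R]_n) : Prop :=
  {in V &, forall s s', ans s x = ans s' x}.

Hypothesis good_inj : forall s s' x, good s x -> good s' x -> s = s'.
(** Think of [entropy] as the number of unknown bits. Either the query has a known answer, or it
    tests one bit: in [u1] the bit is bad and settles the answer, in [u2] it is good and the same
    query is still open. *)
Hypothesis split_cell : forall u x,
  answer_constant (cell u) x \/
  exists u1 u2, [/\ (entropy u1).+1 = entropy u, (entropy u2).+1 = entropy u,
    cell u \subset cell u1 :|: cell u2 & answer_constant (cell u1) x].

(* Pascal's recursion for partial sums of binomial coefficients, in the form
   of the bound [(3/2)^m * 2^t] for the number of subsets of size at most [t]
   of an [m]-element set. *)
Lemma card_solved_within t A u :
  (#|[set s in cell u | solved_within (ans s) (good s) t A]| * 2 ^ entropy u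
     <= 2 ^ t * 3 ^ entropy u)%N.
Proof.
have e23 k : (2 ^ k <= 3 ^ k)%N by elim: k => // k IH; rewrite !expnS leq_mul.
elim: t A u => [|t IH] A u.
  rewrite mul1n; case E : (A [::]) => [x|x].
    rewrite (_ : [set _ in _ | _] = finset.set0) ?cards0 ?mul0n//.
    by apply/setP => s; rewrite !inE /= E andbF.
  rewrite (leq_trans _ (e23 _))// -[leqRHS]mul1n leq_mul2r.
  apply/orP; right; apply/card_le1_eqP => s s'; rewrite !inE /= E.
  by move=> /andP[_ h] /andP[_ h']; exact: good_inj h' h.
case E : (A [::]) => [x|x]; last first.
  rewrite (leq_trans (_ : _ <= 2 ^ entropy u)%N)//.
    rewrite -[leqRHS]mul1n leq_mul2r; apply/orP; right.
    apply/card_le1_eqP => s s'; rewrite !inE /= E.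
    by move=> /andP[_ h] /andP[_ h']; exact: good_inj h' h.
  by rewrite (leq_trans (e23 _))// leq_pmull// expn_gt0.
(* All instances in such a cell give the same answer, so they are all left with the same strategy
   and one query less. *)
have const v : answer_constant (cell v) x ->
    (#|[set s in cell v | solved_within (ans s) (good s) t.+1 A]| * 2 ^ entropy v
      <= 2 ^ t * 3 ^ entropy v)%N.
  move=> cst; have [->|[s0 s0v]] := finset.set_0Vmem (cell v).
    by rewrite (_ : [set _ in _ | _] = finset.set0) ?cards0//; apply/setP => s; rewrite !inE.
  apply: leq_trans (IH (fun h => A (ans s0 x :: h)) v); rewrite leq_mul2r.
  apply/orP; right; apply/subset_leq_card/fintype.subsetP => s; rewrite !inE /= E.
  by case/andP => sv; rewrite sv (cst s s0).
have [k mk] : exists k, entropy u = k by exists (entropy u).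
(* The query stays fixed in this inner induction, which runs through the bits that it tests. *)
elim: k u mk => [|k IHk] u mk.
  have [cst|[u1 [u2 [mu1]]]] := split_cell u x; last by rewrite -mu1 in mk.
  by apply: leq_trans (const u cst) _; rewrite leq_mul2r leq_exp2l// leqnSn orbT.
have [cst|[u1 [u2 [mu1 mu2 sub cst]]]] := split_cell u x.
  by apply: leq_trans (const u cst) _; rewrite leq_mul2r leq_exp2l// leqnSn orbT.
have := const u1 cst; have := IHk u2.
have -> : entropy u1 = k by apply: succn_inj; rewrite mu1.
have -> : entropy u2 = k by apply: succn_inj; rewrite mu2.
move=> /(_ erefl); rewrite mk.
set N1 := #|[set s in cell u1 | _]|; set N2 := #|[set s in cell u2 | _]|.
set N := #|_|.
have : (N <= N1 + N2)%N.
  apply: leq_trans (leq_card_setU _ _); apply/subset_leq_card/fintype.subsetP => s.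
  by rewrite !inE => /andP[/(fintype.subsetP sub)]; rewrite !inE => /orP[]-> ->; rewrite ?orbT.
(* The bad branch has one query less, the good one has not: the sum is 2 (2^t 3^k + 2^(t+1) 3^k) =
   2^(t+1) 3^(k+1). *)
by rewrite !expnS; nia.
Qed.

End GuessingGame.

(** * The sup norm and the unit ball *)

(** Ties go to the smallest index, as the single-coordinate rule demands. *)
Lemma lex_argmax (R : realType) (n : nat) (U : 'I_n -> R) : (0 < n)%N ->
  exists k, (forall j, U j <= U k) /\ (forall j : 'I_n, (j < k)%N -> U j < U k).
Proof.
move=> n0; have [i _ iP] := @Order.TotalTheory.arg_maxP _ _ 'I_n (Ordinal n0) xpredT U isT.
have /= [k /eqP Uk kP] := @fintype.arg_minnP 'I_n i (fun j => U j == U i) val (eqxx _).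
exists k; rewrite Uk; split=> [j|j jk]; first exact: iP.
rewrite lt_neqAle [U j <= _]iP// andbT; apply/negP => /kP.
by rewrite leqNgt jk.
Qed.

Section SupNorm.
Variables (R : realType) (n : nat).
Implicit Types (x y g : 'rV[R]_n).

Definition sup_norm x : R := \big[Num.max/0]_(i < n) `|x 0 i|.

Lemma sup_norm_ge x i : `|x 0 i| <= sup_norm x.
Proof. exact: le_bigmax. Qed.

Lemma sup_norm_ge0 x : 0 <= sup_norm x.
Proof. exact: bigmax_ge_id. Qed.

Lemma sup_norm_leP x a : 0 <= a -> reflect (forall i, `|x 0 i| <= a) (sup_norm x <= a).
Proof.
move=> a0; apply: (iffP (bigmax_leP _ _ _ _)) => [[_ h] i|h]; first exact: h.
by split => // i _; exact: h.
Qed.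

Lemma sup_norm_convex x y (t : R) : 0 <= t <= 1 ->
  sup_norm (t *: x + (1 - t) *: y) <= t * sup_norm x + (1 - t) * sup_norm y.
Proof.
move=> /andP[t0]; rewrite -subr_ge0 => t1.
apply/sup_norm_leP => [|i]; first by rewrite addr_ge0// mulr_ge0// sup_norm_ge0.
rewrite !mxE (le_trans (ler_normD _ _))// !normrM (ger0_norm t0) (ger0_norm t1).
by rewrite lerD// ler_wpM2l// sup_norm_ge.
Qed.

Lemma sum_delta_mx (mu : R) (k : 'I_n) (z : 'I_n -> R) :
  \sum_(i < n) (mu *: delta_mx 0 k : 'rV[R]_n) 0 i * z i = mu * z k.
Proof.
rewrite (bigD1 k)//= !mxE !eqxx mulr1 big1 ?addr0// => i ik.
by rewrite !mxE (negbTE ik) andbF mulr0 mul0r.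
Qed.

Lemma sum_gradient_line g x y (t : R) :
  \sum_(i < n) g 0 i * ((t *: y + (1 - t) *: x) 0 i - x 0 i)
  = t * \sum_(i < n) g 0 i * (y 0 i - x 0 i).
Proof. by rewrite mulr_sumr; apply: eq_bigr => i _; rewrite !mxE; ring. Qed.

End SupNorm.

Section LpBall.
Variables (R : realType) (p : R) (n : nat).
Hypothesis p1 : 1 <= p.
Implicit Types (x y : 'rV[R]_n).

Let p0 : 0 < p. Proof. exact: lt_le_trans p1. Qed.

Lemma coord_le_lp_norm x i : `|x 0 i| <= lp_norm p x.
Proof.
rewrite -[leLHS](@powRr1 _ _)// -(divff (lt0r_neq0 p0)) powRrM.
apply: ge0_ler_powR; rewrite ?invr_ge0 ?(ltW p0)// ?nnegrE ?powR_ge0//.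
  by apply: sumr_ge0 => j _; exact: powR_ge0.
by rewrite (bigD1 i)//= lerDl sumr_ge0// => j _; exact: powR_ge0.
Qed.

Lemma lp_ballE x : lp_ball p x <-> \sum_(i < n) `|x 0 i| `^ p <= 1.
Proof.
rewrite /lp_ball/= /lp_norm.
have s0 : 0 <= \sum_(i < n) `|x 0 i| `^ p by apply: sumr_ge0 => j _; exact: powR_ge0.
split => h; last first.
  have one : (1 : R) = 1 `^ p^-1 by rewrite powR1.
  by rewrite [leRHS]one; apply: ge0_ler_powR; rewrite ?invr_ge0 ?(ltW p0)// ?nnegrE.
have one : (1 : R) = 1 `^ p by rewrite powR1.
move: h; set S := \sum_(i < n) _ => h.
have -> : S = (S `^ p^-1) `^ p by rewrite -powRrM mulVf ?powRr1// lt0r_neq0.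
rewrite one.
by apply: ge0_ler_powR; rewrite ?(ltW p0)// ?nnegrE ?powR_ge0.
Qed.

Lemma lp_ball_convex x y (t : R) : 0 <= t <= 1 -> lp_ball p x -> lp_ball p y ->
  lp_ball p (t *: x + (1 - t) *: y).
Proof.
move=> t01 /lp_ballE hx /lp_ballE hy; apply/lp_ballE.
have /andP[t0 t1] := t01.
have cvx (a b : R) : `|t * a + (1 - t) * b| `^ p <= t * `|a| `^ p + (1 - t) * `|b| `^ p.
  apply: (@le_trans _ _ ((t * `|a| + (1 - t) * `|b|) `^ p)).
    have u0 : 0 <= 1 - t by rewrite subr_ge0.
    apply: ge0_ler_powR; rewrite ?(ltW p0) ?nnegrE ?addr_ge0 ?mulr_ge0//.
    by rewrite (le_trans (ler_normD _ _))// !normrM (ger0_norm t0) (ger0_norm u0).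
  have := @convex_powR _ _ p1 (Itv01 t0 t1) `|a| `|b|.
  by rewrite !convRE/= /unstable.onem; apply; rewrite inE/= in_itv/= andbT.
apply: (@le_trans _ _ (\sum_(i < n) (t * `|x 0 i| `^ p + (1 - t) * `|y 0 i| `^ p))).
  by apply: ler_sum => i _; rewrite !mxE cvx.
rewrite big_split/= -!mulr_sumr.
apply: (@le_trans _ _ (t * 1 + (1 - t) * 1)); last by rewrite !mulr1 subrKC.
by rewrite lerD// ler_wpM2l// subr_ge0.
Qed.

Lemma lp_ball_cube x : (0 < n)%N -> sup_norm x <= n%:R `^ (- p^-1) -> lp_ball p x.
Proof.
move=> n0 h; have hx i := le_trans (sup_norm_ge x i) h; apply/lp_ballE.
apply: (@le_trans _ _ (\sum_(i < n) n%:R^-1)).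
  have -> : n%:R^-1 = (n%:R `^ (- p^-1)) `^ p :> R.
    by rewrite -powRrM mulNr mulVf ?powR_inv1// lt0r_neq0.
  by apply: ler_sum => i _; apply: ge0_ler_powR; rewrite ?(ltW p0) ?nnegrE ?powR_ge0.
by rewrite sumr_const card_ord -[leLHS]mulr_natr mulVf// pnatr_eq0 -lt0n.
Qed.

End LpBall.

(** * The hard family and its oracle *)

Section HardFamily.
Variables (R : realType) (n M : nat) (r : R).
Hypotheses (n_gt0 : (0 < n)%N) (r_gt0 : 0 < r).
Notation code := {ffun 'I_n -> M.-tuple bool}.
Implicit Types (s : code) (x y g : 'rV[R]_n) (X : set 'rV[R]_n).

Definition hard_coord s x k : R := r * zigzag (s k) (x 0 k / r).

Definition hard_obj s x : R := \big[Num.max/0]_(k < n) hard_coord s x k.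

Definition hard_slope s x k : R := zigzag_slope (s k) (x 0 k / r).

Definition first_active s x (k : 'I_n) : bool :=
  (hard_obj s x == hard_coord s x k) &&
  [forall j : 'I_n, (j < k)%N ==> (hard_coord s x j < hard_coord s x k)].

Definition coord_subgradient X (f : 'rV[R]_n -> R) x : set 'rV[R]_n :=
  [set g | exists (k : 'I_n) (lambda : R), [/\ g = lambda *: delta_mx 0 k,
    subgradient X f x g &
    forall (j : 'I_n) (mu : R), (j < k)%N ->
      ~ subgradient X f x (mu *: delta_mx 0 j)]].

(* Outside the cube of radius [r] every function of the family is locally the
   sup norm; as boundary points of [X] may have additional subgradients, the
   answer there is chosen once and for all for the sup norm on [X]. *)
Definition hard_oracle X s x : answer R n :=
  (hard_obj s x,
   if r < sup_norm x then xget 0 (coord_subgradient X (@sup_norm R n) x)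
   else if [pick k | first_active s x k] is Some k
        then hard_slope s x k *: delta_mx 0 k else 0).

Lemma hard_coord_ge_norm s x k : `|x 0 k| <= hard_coord s x k.
Proof.
have := zigzag_ge_norm (s k) (x 0 k / r).
by rewrite normrM normfV (gtr0_norm r_gt0) ler_pdivrMr// mulrC.
Qed.

Lemma hard_coord_le s x k : hard_coord s x k <= Num.max r `|x 0 k|.
Proof.
have := zigzag_le (s k) (x 0 k / r).
rewrite normrM normfV (gtr0_norm r_gt0) !le_max => /orP[h|].
  by rewrite -[X in _ <= X]mulr1 ler_pM2l ?h.
by rewrite ler_pdivlMr// mulrC => ->; rewrite orbT.
Qed.

Lemma hard_coord_le_obj s x k : hard_coord s x k <= hard_obj s x.
Proof. exact: le_bigmax. Qed.

Lemma hard_coord_ge0 s x k : 0 <= hard_coord s x k.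
Proof. exact: le_trans (hard_coord_ge_norm s x k). Qed.

Lemma hard_obj_leP s x a : 0 <= a ->
  (forall k, hard_coord s x k <= a) -> hard_obj s x <= a.
Proof. by move=> a0 h; apply/bigmax_leP; split. Qed.

Lemma hard_obj_ge0 s x : 0 <= hard_obj s x.
Proof. exact: bigmax_ge_id. Qed.

Lemma hard_obj_ge_sup_norm s x : sup_norm x <= hard_obj s x.
Proof.
apply/sup_norm_leP => [|i]; first exact: hard_obj_ge0.
exact: le_trans (hard_coord_ge_norm s x i) (hard_coord_le_obj s x i).
Qed.

(** All instances coincide outside the cube, so a query there reveals nothing. *)
Lemma hard_obj_outside s x : r <= sup_norm x -> hard_obj s x = sup_norm x.
Proof.
move=> rx; apply/eqP; rewrite eq_le hard_obj_ge_sup_norm andbT.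
apply: hard_obj_leP => [|k]; first exact: sup_norm_ge0.
by rewrite (le_trans (hard_coord_le s x k))// ge_max rx sup_norm_ge.
Qed.

Lemma hard_coord_ge_min s x k : r * zigzag_min R M <= hard_coord s x k.
Proof.
by rewrite ler_pM2l// -[M in leLHS](size_tuple (s k)) zigzag_ge_min.
Qed.

Lemma min_ge0 : 0 <= r * zigzag_min R M.
Proof. by have /andP[? _] := zigzag_min_bounds R M; rewrite mulr_ge0// ltW. Qed.

Lemma hard_obj_ge_min s x : r * zigzag_min R M <= hard_obj s x.
Proof.
exact: le_trans (hard_coord_ge_min s x (Ordinal n_gt0)) (hard_coord_le_obj _ _ _).
Qed.

Definition hard_argmin s : 'rV[R]_n := \row_k (r * zigzag_argmin R (s k)).

Lemma hard_coord_argmin s x k : x 0 k = hard_argmin s 0 k ->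
  hard_coord s x k = r * zigzag_min R M.
Proof.
rewrite /hard_coord mxE => ->; rewrite [X in zigzag _ X]mulrC mulKf ?lt0r_neq0//.
by rewrite zigzag_argminE size_tuple.
Qed.

Lemma hard_obj_argmin s : hard_obj s (hard_argmin s) = r * zigzag_min R M.
Proof.
apply/eqP; rewrite eq_le hard_obj_ge_min andbT.
by apply: hard_obj_leP => [|k]; rewrite ?min_ge0// hard_coord_argmin.
Qed.

Lemma hard_argmin_cube s k : `|hard_argmin s 0 k| <= r.
Proof.
rewrite mxE normrM (gtr0_norm r_gt0) -[leRHS]mulr1 ler_pM2l//.
by apply: le_trans (zigzag_argmin_bound R (s k)) _; lra.
Qed.

Lemma hard_obj_lipschitz s x y : `|hard_obj s x - hard_obj s y| <= sup_norm (x - y).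
Proof.
have half x' y' : hard_obj s x' <= hard_obj s y' + sup_norm (x' - y').
  apply: hard_obj_leP => [|k]; first by rewrite addr_ge0 ?hard_obj_ge0 ?sup_norm_ge0.
  apply: (@le_trans _ _ (hard_coord s y' k + `|(x' - y') 0 k|)); last first.
    by rewrite lerD ?hard_coord_le_obj ?sup_norm_ge.
  have := zigzag_le_shift (s k) (x' 0 k / r) (y' 0 k / r).
  rewrite -mulrBl normrM normfV (gtr0_norm r_gt0) !mxE.
  rewrite -(ler_pM2l r_gt0) mulrDr => /le_trans; apply.
  by rewrite [r * (_ / r)]mulrC mulfVK ?lt0r_neq0.
rewrite ler_norml; have := half x y; have := half y x.
rewrite (_ : sup_norm (y - x) = sup_norm (x - y)); last first.
  by apply: eq_bigr => i _; rewrite !mxE distrC.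
by move=> ? ?; apply/andP; split; lra.
Qed.

Lemma hard_obj_convex s X : convex_function X (hard_obj s).
Proof.
move=> t x y _ _.
have -> : conv t (hard_obj s x : R^o) (hard_obj s y : R^o) =
    t%:num * hard_obj s x + (1 - t%:num) * hard_obj s y by rewrite convRE.
have -> : conv t x y = (t%:num : R) *: (x : 'rV[R]_n) + (1 - t%:num) *: (y : 'rV[R]_n).
  by [].
have t0 : 0 <= t%:num :> R by [].
have t1 : 0 <= 1 - t%:num :> R by rewrite subr_ge0.
apply: hard_obj_leP => [|k]; first by rewrite addr_ge0// mulr_ge0 ?hard_obj_ge0.
apply: (@le_trans _ _ (t%:num * hard_coord s x k + (1 - t%:num) * hard_coord s y k)).
  rewrite /hard_coord [X in X <= _]mulrC !mxE mulrDl -!mulrA.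
  have := @zigzag_convex R (s k) (x 0 k / r) (y 0 k / r) t%:num.
  rewrite t0 -subr_ge0 t1 => /(_ isT); rewrite -(ler_pM2l r_gt0) mulrC.
  by move/le_trans; apply; rewrite le_eqVlt; apply/orP; left; apply/eqP; ring.
by rewrite lerD// ler_wpM2l// hard_coord_le_obj.
Qed.

Lemma hard_oracle_first X s x k : ~~ (r < sup_norm x) ->
  (forall j, hard_coord s x j <= hard_coord s x k) ->
  (forall j : 'I_n, (j < k)%N -> hard_coord s x j < hard_coord s x k) ->
  hard_oracle X s x = (hard_coord s x k, hard_slope s x k *: delta_mx 0 k).
Proof.
move=> xin kmax kfirst.
have objE : hard_obj s x = hard_coord s x k.
  apply/eqP; rewrite eq_le hard_coord_le_obj andbT.
  by apply: hard_obj_leP; rewrite ?hard_coord_ge0.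
rewrite /hard_oracle (negbTE xin) objE; congr pair.
case: pickP => [k'|/(_ k)]; last first.
  by rewrite /first_active objE eqxx/= => /negP[]; apply/forallP => j; apply/implyP/kfirst.
rewrite /first_active objE => /andP[/eqP e /forallP h].
have [kk'|k'k|/val_inj->//] := ltngtP k k'.
  by have := h k; rewrite kk' e ltxx.
by have := kfirst _ k'k; rewrite e ltxx.
Qed.

Lemma hard_oracle_query X s x : ~~ (r < sup_norm x) ->
  exists k, [/\ forall j, hard_coord s x j <= hard_coord s x k,
    forall j : 'I_n, (j < k)%N -> hard_coord s x j < hard_coord s x k,
    hard_obj s x = hard_coord s x k &
    hard_oracle X s x = (hard_coord s x k, hard_slope s x k *: delta_mx 0 k)].
Proof.
move=> xin; have [k [k1 k2]] := lex_argmax (hard_coord s x) n_gt0.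
exists k; have e := hard_oracle_first X xin k1 k2.
by split => //; move: e => /(congr1 fst).
Qed.

(** A maximum below the threshold puts every coordinate below it, and [zigzag_sep] recovers the code
    coordinate by coordinate. *)
Lemma hard_obj_sep s s' x :
  hard_obj s x < r * (zigzag_min R M + 16^-1 ^+ M / 4) ->
  hard_obj s' x < r * (zigzag_min R M + 16^-1 ^+ M / 4) -> s = s'.
Proof.
move=> h h'; apply/ffunP => k; apply: val_inj.
have coord s1 : hard_obj s1 x < r * (zigzag_min R M + 16^-1 ^+ M / 4) ->
    zigzag (s1 k) (x 0 k / r) < zigzag_min R M + 16^-1 ^+ M / 4.
  by move=> h1; rewrite -(ltr_pM2l r_gt0); apply: le_lt_trans h1; exact: hard_coord_le_obj.
by apply: (@zigzag_sep R _ _ (x 0 k / r)); rewrite !size_tuple//; exact: coord.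
Qed.

End HardFamily.

Section HardOracle.
Variables (R : realType) (n M : nat) (r : R) (X : set 'rV[R]_n).
Hypotheses (n_gt0 : (0 < n)%N) (r_gt0 : 0 < r).
Hypothesis X_cube : forall x, sup_norm x <= r -> X x.
Hypothesis X_convex : forall x y (t : R), 0 <= t <= 1 -> X x -> X y ->
  X (t *: x + (1 - t) *: y).
Notation code := {ffun 'I_n -> M.-tuple bool}.
Implicit Types (s : code) (x y g : 'rV[R]_n).

Lemma hard_subgradient s x k : hard_obj r s x = hard_coord r s x k ->
  subgradient X (hard_obj r s) x (hard_slope r s x k *: delta_mx 0 k).
Proof.
move=> e y _; rewrite (sum_delta_mx _ _ (fun i => y 0 i - x 0 i)) e.
apply: le_trans (hard_coord_le_obj r s y k).
have := zigzag_subgradient (s k) (x 0 k / r) (y 0 k / r).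
rewrite -mulrBl -(ler_pM2l r_gt0); apply: le_trans.
rewrite le_eqVlt; apply/orP; left; apply/eqP.
by rewrite /hard_coord /hard_slope; field; exact: lt0r_neq0.
Qed.

(* Outside the cube the family agrees with the sup norm near [x], and a
   subgradient inequality near [x] extends to [X] along segments. *)
Lemma subgradient_outside s x g : X x -> r < sup_norm x ->
  subgradient X (hard_obj r s) x g <-> subgradient X (@sup_norm R n) x g.
Proof.
move=> Xx rx; have ex := hard_obj_outside r_gt0 s (ltW rx).
split=> h y Xy; last first.
  by rewrite ex; apply: le_trans (h y Xy) _; exact: hard_obj_ge_sup_norm.
pose D := sup_norm (y - x) + 1.
have D1 : 1 <= D by rewrite lerDr sup_norm_ge0.
have D0 : 0 < D by apply: lt_le_trans D1.
(* A step of this length lowers the sup norm by at most [sup_norm x - r], so [z] does not enter the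
   interior of the cube. *)
pose t := Num.min 1 ((sup_norm x - r) / D).
have t0 : 0 < t by rewrite lt_min ltr01 divr_gt0// subr_gt0.
have t1 : t <= 1 by rewrite ge_min lexx.
have t01 : 0 <= t <= 1 by rewrite (ltW t0).
pose z := t *: y + (1 - t) *: x.
have Xz : X z by exact: X_convex.
have rz : r <= sup_norm z.
  have tD : t * D <= sup_norm x - r by rewrite -ler_pdivlMr// ge_min lexx orbT.
  have tS : t * sup_norm (y - x) <= t * D by rewrite ler_pM2l// lerDl.
  suff : sup_norm x <= sup_norm z + t * sup_norm (y - x) by lra.
  apply/sup_norm_leP => [|i].
    by rewrite addr_ge0 ?sup_norm_ge0// mulr_ge0 ?sup_norm_ge0// ltW.
  have := sup_norm_ge z i; have := sup_norm_ge (y - x) i.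
  have : `|x 0 i| <= `|z 0 i| + t * `|(y - x) 0 i|.
    rewrite -[X in _ <= _ + X * _](gtr0_norm t0) -normrM.
    rewrite (_ : x 0 i = z 0 i - t * (y - x) 0 i); first exact: ler_normB.
    by rewrite !mxE; ring.
  move=> a b c; apply: le_trans a _; apply: lerD => //.
  by rewrite ler_pM2l.
have := h z Xz; rewrite ex hard_obj_outside// sum_gradient_line => hz.
have cvx := sup_norm_convex y x t01.
rewrite -(ler_pM2l t0); move: (le_trans hz cvx).
by set S := \sum_(i < n) _ => {}hz; lra.
Qed.

(** This ensures that [xget] in [hard_oracle] never falls back to its default. The sign of a largest
    coordinate gives one subgradient of the required form; then the smallest possible index is
    taken. *)
Lemma sup_norm_coord_subgradient x :
  (coord_subgradient X (@sup_norm R n) x !=set0)%classic.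
Proof.
pose P k := `[< exists lambda, subgradient X (@sup_norm R n) x (lambda *: delta_mx 0 k) >].
have [k0 [k0max _]] := lex_argmax (fun i => `|x 0 i|) n_gt0.
have e0 : sup_norm x = `|x 0 k0|.
  by apply/eqP; rewrite eq_le sup_norm_ge andbT; apply/sup_norm_leP.
have Pk0 : P k0.
  apply/asboolP; exists (Num.sg (x 0 k0)) => y _.
  rewrite (sum_delta_mx _ _ (fun i => y 0 i - x 0 i)) e0.
  apply: le_trans (sup_norm_ge y k0).
  exact: (zigzag_subgradient [::] (x 0 k0) (y 0 k0)).
have [k /asboolP[lambda Pk] kmin] := @fintype.arg_minnP 'I_n k0 P val Pk0.
exists (lambda *: delta_mx 0 k), k, lambda; split=> // j mu jk hj.
by have := kmin j; rewrite leqNgt jk => /(_ _)/negP; apply => //; apply/asboolP; exists mu.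
Qed.

Lemma hard_oracle_subgradient s x : X x ->
  coord_subgradient X (hard_obj r s) x (hard_oracle r X s x).2.
Proof.
move=> Xx; have [rx|xin] := boolP (r < sup_norm x).
  rewrite /hard_oracle rx /=.
  have [g] := sup_norm_coord_subgradient x.
  move=> /(xgetI 0) [k [lambda [-> h1 h2]]].
  exists k, lambda; split => //; first exact/subgradient_outside.
  by move=> j mu jk /(subgradient_outside s _ Xx rx); exact: h2.
have [k [kmax kfirst objE ->]] := hard_oracle_query n_gt0 r_gt0 X s xin.
exists k, (hard_slope r s x k); split => //=; first exact: hard_subgradient.
move=> j mu jk.
(* Keep coordinate [j] of [x] and minimize in all others. A subgradient along [j] would force a
   value at [y] no smaller than at [x], but the value at [y] is at most the non-maximal
   [hard_coord r s x j]. *)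
pose y : 'rV[R]_n := \row_i (if i == j then x 0 i else hard_argmin r s 0 i).
have y_cube : sup_norm y <= r.
  rewrite -leNgt in xin.
  apply/sup_norm_leP => [|i]; first exact: ltW.
  rewrite mxE; case: ifP => _; last exact: hard_argmin_cube.
  exact: le_trans (sup_norm_ge x i) xin.
move=> /(_ y (X_cube y_cube)); apply/negP; rewrite -ltNge.
rewrite (sum_delta_mx _ _ (fun i => y 0 i - x 0 i)) mxE eqxx subrr mulr0 addr0 objE.
apply: le_lt_trans (kfirst j jk).
apply: hard_obj_leP => [|i]; first exact: hard_coord_ge0.
have [->|ij] := eqVneq i j; first by rewrite /hard_coord mxE eqxx.
rewrite hard_coord_argmin// ?hard_coord_ge_min//.
by rewrite mxE (negbTE ij).
Qed.

Definition hard_family : family R n := Family (hard_obj r : code -> _).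

Lemma hard_first_order : first_order X (F := hard_family) (hard_oracle r X).
Proof. by move=> s x Xx; split=> //; have [? [? []]] := hard_oracle_subgradient s Xx. Qed.

Lemma hard_single_coordinate : single_coordinate X (F := hard_family) (hard_oracle r X).
Proof.
move=> s x Xx; have [k [lambda [e _ h]]] := hard_oracle_subgradient s Xx.
by exists k, lambda.
Qed.

Lemma hard_family_lipschitz p :
  (forall x i, `|x 0 i| <= lp_norm p x) -> convex_lipschitz_family p X hard_family.
Proof.
move=> le_lp; split=> [|s s' h|s|s x y _ _].
- by apply/card_gt0P; exists [ffun=> [tuple of nseq M false]].
(* Distinct codes give distinct functions: otherwise the minimizer of [s] would also be one for
   [s'], against the separation. *)
- have gap : 0 < (16^-1 : R) ^+ M / 4 by rewrite divr_gt0// exprn_gt0// invr_gt0.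
  have Xs : X (hard_argmin r s).
    apply: X_cube; apply/sup_norm_leP => [|k]; first exact: ltW.
    exact: hard_argmin_cube.
  have e := hard_obj_argmin n_gt0 r_gt0 s.
  have e' : hard_obj r s' (hard_argmin r s) = r * zigzag_min R M by rewrite -e; symmetry; exact: (h _ Xs).
  by apply: (@hard_obj_sep R n M r r_gt0 s s' (hard_argmin r s));
    rewrite ?e ?e' ltr_pM2l// ltrDl.
- exact: hard_obj_convex.
- apply: le_trans (hard_obj_lipschitz r_gt0 s x y) _.
  by apply/sup_norm_leP => [|i]; [exact: powR_ge0|exact: le_lp].
Qed.

Lemma hard_eps_minimum_inj s s' (eps : R) x :
  eps <= r * (16^-1 ^+ M / 4) ->
  eps_minimum X (hard_obj r s) eps x -> eps_minimum X (hard_obj r s') eps x -> s = s'.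
Proof.
move=> heps.
have small s1 : eps_minimum X (hard_obj r s1) eps x ->
    hard_obj r s1 x < r * (zigzag_min R M + 16^-1 ^+ M / 4).
  case=> _ [xm [_ xmin h]]; apply: lt_le_trans h _; rewrite mulrDr lerD//.
  rewrite -(hard_obj_argmin n_gt0 r_gt0 s1); apply: xmin; apply: X_cube.
  by apply/sup_norm_leP => [|k]; [exact: ltW|exact: hard_argmin_cube].
by move=> /small h /small; exact: hard_obj_sep.
Qed.

(** The state of knowledge is a prefix of the code in each coordinate; the prefixes may have
    different lengths. *)
Definition hard_cell (u : 'I_n -> seq bool) : {set code} :=
  [set s : code | [forall k, seq.prefix (u k) (s k)]].

Definition hard_entropy (u : 'I_n -> seq bool) : nat := \sum_(k < n) (M - size (u k)).

Definition extend (u : 'I_n -> seq bool) k b : 'I_n -> seq bool :=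
  fun j => if j == k then rcons (u j) b else u j.

Lemma hard_entropy_extend u k b : (size (u k) < M)%N ->
  (hard_entropy (extend u k b)).+1 = hard_entropy u.
Proof.
move=> uM; rewrite /hard_entropy (bigD1 k)//= [in RHS](bigD1 k)//=.
rewrite /extend eqxx size_rcons -addSn subnS prednK ?subn_gt0//.
by congr addn; apply: eq_bigr => j /negbTE ->.
Qed.

Lemma hard_cellP u s : reflect (forall k, exists v, s k = u k ++ v :> seq bool) (s \in hard_cell u).
Proof.
rewrite inE; apply: (iffP forallP) => h k; first by have /prefixP := h k.
by apply/prefixP; exact: h.
Qed.

Lemma hard_cell_extend u k b : (size (u k) < M)%N ->
  hard_cell u \subset hard_cell (extend u k b) :|: hard_cell (extend u k (~~ b)).
Proof.
move=> uM; apply/fintype.subsetP => s /hard_cellP su.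
have [[|c v] e] := su k.
  by have := size_tuple (s k); rewrite e cats0 => E; rewrite E ltnn in uM.
suff h : s \in hard_cell (extend u k c).
  by rewrite inE; have [<-|cb] := eqVneq c b; rewrite ?h//; move: cb h;
    case: c {e} => //; case: b => //= _ ->; rewrite orbT.
apply/hard_cellP => j; rewrite /extend; case: eqP => [->|_]; last exact: su.
by exists v; rewrite cat_rcons.
Qed.

(* Among the coordinates, the one with the largest value still possible
   answers the query once its next bit is the bad one. *)
Lemma hard_cell_split u x :
  answer_constant (hard_oracle r X) (hard_cell u) x \/
  exists u1 u2, [/\ (hard_entropy u1).+1 = hard_entropy u,
    (hard_entropy u2).+1 = hard_entropy u,
    hard_cell u \subset hard_cell u1 :|: hard_cell u2 &
    answer_constant (hard_oracle r X) (hard_cell u1) x].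
Proof.
have [rx|xin] := boolP (r < sup_norm x).
  left=> s s' _ _; rewrite /hard_oracle rx.
  by rewrite !hard_obj_outside ?(ltW rx).
(* The largest value of coordinate [k] over the cell; a completely known code contributes its actual
   value. *)
pose U k := r * (if (size (u k) < M)%N then zigzag_cap (u k) (x 0 k / r)
                 else zigzag (u k) (x 0 k / r)).
have full k s : s \in hard_cell u -> ~~ (size (u k) < M)%N -> s k = u k :> seq bool.
  move=> /hard_cellP/(_ k)[v e]; rewrite -leqNgt => uM.
  have := size_tuple (s k); rewrite e size_cat => E.
  have v0 : v = [::] by apply: size0nil; lia.
  by rewrite v0 cats0.
have leU k s : s \in hard_cell u -> hard_coord r s x k <= U k.
  move=> su; rewrite /hard_coord ler_pM2l//; case: ifPn => [uM|/full->//].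
  by have /hard_cellP/(_ k)[v ->] := su; exact: zigzag_le_cap.
have [k [kmax kfirst]] := lex_argmax U n_gt0.
(* When coordinate [k] attains its bound, it is the first active one whatever the other unknown bits
   are, since [k] is the first maximizer of the bounds. *)
have const s : s \in hard_cell u -> hard_coord r s x k = U k ->
    hard_oracle r X s x = (U k, hard_slope r s x k *: delta_mx 0 k).
  move=> su e; rewrite -e; apply: hard_oracle_first => // j.
    by rewrite e (le_trans (leU j s su)).
  by move=> jk; rewrite e (le_lt_trans (leU j s su))// kfirst.
have [uM|uM] := boolP (size (u k) < M)%N; last first.
  left=> s s' su su'; rewrite !const// /hard_coord /hard_slope /U ?(negbTE uM) ?full//.
have [b [c bc]] := zigzag_cap_attained (u k) (x 0 k / r).
right; exists (extend u k b), (extend u k (~~ b)).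
split; rewrite ?hard_entropy_extend ?hard_cell_extend//.
have ext s : s \in hard_cell (extend u k b) ->
    hard_oracle r X s x = (U k, c *: delta_mx 0 k).
  move=> /hard_cellP se; have := se k; rewrite /extend eqxx => -[v].
  rewrite cat_rcons => e; rewrite const.
  - by rewrite /hard_slope e; have [_ ->] := bc v.
  - apply/hard_cellP => j; have := se j; rewrite /extend; case: eqP => // _ [w].
    by rewrite cat_rcons; exists (b :: w).
  - by rewrite /hard_coord /U uM e; have [-> _] := bc v.
by move=> s s' /ext -> /ext ->.
Qed.

Lemma card_hard_solved (eps : R) t (A : strategy R n) :
  eps <= r * (16^-1 ^+ M / 4) ->
  (#|[set s : code | solved_within (hard_oracle r X s)
       (fun x => `[< eps_minimum X (hard_obj r s) eps x >]) t A]| * 2 ^ (n * M)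
     <= 2 ^ t * 3 ^ (n * M))%N.
Proof.
move=> heps.
have inj s s' x : `[< eps_minimum X (hard_obj r s) eps x >] ->
    `[< eps_minimum X (hard_obj r s') eps x >] -> s = s'.
  by move=> /asboolP h /asboolP; exact: hard_eps_minimum_inj h.
have := card_solved_within inj hard_cell_split t A (fun=> [::]).
rewrite /hard_entropy sum_nat_const card_ord subn0.
apply: leq_trans; rewrite leq_mul2r; apply/orP; right.
apply/subset_leq_card/fintype.subsetP => s; rewrite !inE => ->; rewrite andbT.
by apply/forallP => k; rewrite prefix0s.
Qed.

End HardOracle.

(** * Randomized algorithms *)

Section UniformMean.
Variables (R : realType) (I : finType).
Implicit Types (f g : I -> \bar R).
Local Open Scope ereal_scope.

Let card_inv_ge0 : 0 <= ((#|I|%:R : R)^-1)%:E.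
Proof. by rewrite lee_fin invr_ge0. Qed.

Lemma le_uniform_mean f g : (forall i, f i <= g i) -> uniform_mean f <= uniform_mean g.
Proof. by move=> fg; apply: lee_wpmul2l => //; exact: lee_sum. Qed.

Lemma uniform_meanD f g : (forall i, 0 <= f i) -> (forall i, 0 <= g i) ->
  uniform_mean (fun i => f i + g i) = uniform_mean f + uniform_mean g.
Proof.
by move=> f0 g0; rewrite /uniform_mean big_split/= ge0_muleDr// sume_ge0.
Qed.

Lemma uniform_meanZl (a : R) f : (forall i, 0 <= f i) ->
  uniform_mean (fun i => a%:E * f i) = a%:E * uniform_mean f.
Proof. by move=> f0; rewrite /uniform_mean -ge0_sume_distrr// muleCA. Qed.

End UniformMean.

Section Probability.
Variables (R : realType) (d : measure_display) (W : measurableType d).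
Variable P : probability W R.
Local Open Scope classical_set_scope.
Local Open Scope ereal_scope.

(** Exchange sum and expectation: for each [w] at most [K] of the indicators are 1. *)
Lemma sum_probability_le (I : finType) (B : I -> set W) (K : nat) :
  (forall i, measurable (B i)) ->
  (forall w, (#|[set i | `[< B i w >]]%SET| <= K)%N) ->
  \sum_(i : I) P (B i) <= K%:R%:E.
Proof.
move=> mB BK.
have -> : \sum_(i : I) P (B i) = \sum_(i : I) \int[P]_w (\1_(B i) w)%:E.
  by apply: eq_bigr => i _; rewrite integral_indic// setIT.
have mI i : measurable_fun [set: W] (fun w => (\1_(B i) w)%:E : \bar R).
  by apply/measurable_EFinP; exact: measurable_indic.
rewrite -ge0_integral_sum//.
apply: (@le_trans _ _ (\int[P]_w cst (K%:R%:E) w)); last first.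
  by rewrite integral_cst// -[leRHS]mule1 lee_pmul ?lee_fin// probability_le1.
apply: ge0_le_integral => //.
- by move=> w _; apply: sume_ge0 => i _; rewrite lee_fin.
- exact: emeasurable_sum.
- move=> w _; rewrite sumEFin lee_fin.
  have -> : (\sum_(i : I) \1_(B i) w = #|[set i | `[< B i w >]]%SET|%:R :> R)%R.
    rewrite -sum1_card natr_sum [RHS]big_mkcond/=; apply: eq_bigr => i _.
    rewrite indicE finset.inE; case: asboolP => h; first by rewrite mem_set.
    by rewrite memNset.
  by rewrite ler_nat.
Qed.

Lemma markov_ge0 (f : W -> \bar R) (a : R) : (0 <= a)%R ->
  measurable_fun [set: W] f -> (forall w, 0 <= f w) ->
  a%:E * P [set w | a%:E <= f w] <= \int[P]_w f w.
Proof.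
move=> a0 mf f0.
have mA : measurable [set w | a%:E <= f w].
  by rewrite -[X in measurable X]setTI; exact: emeasurable_fun_c_infty.
rewrite -integral_cst//.
apply: (@le_trans _ _ (\int[P]_(w in [set w | a%:E <= f w]) f w)).
  apply: ge0_le_integral => //; first exact: measurable_funTS.
apply: ge0_subset_integral => //.
Qed.

End Probability.

Section Tail.
Variables (R : realType) (n : nat) (X : set 'rV[R]_n) (F : family R n).
Variables (O : oracle F) (eps : R) (t K : nat).
Hypothesis count : forall A : strategy R n,
  (#|[set i : instance F | solved_within (O i)
        (fun x => `[< eps_minimum X (objective i) eps x >]) t A]%SET| <= K)%N.
Variables (d : measure_display) (W : measurableType d) (P : probability W R).
Variable A : W -> strategy R n.
Hypothesis algA : algorithm X O eps P A.
Local Open Scope classical_set_scope.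
Local Open Scope ereal_scope.

Lemma num_queries_ge0 w (i : instance F) : 0 <= num_queries (A w) (O i).
Proof. by apply: ereal_sup_ubound; exists 0%N. Qed.

Lemma success_solved_within (B : strategy R n) (i : instance F) :
  success X O eps B i -> num_queries B (O i) < t.+1%:R%:E ->
  solved_within (O i) (fun x => `[< eps_minimum X (objective i) eps x >]) t B.
Proof.
move=> [x [[t0 Bx] gx]] few.
apply: (solved_within_history Bx); last exact/asboolP.
have : (size (history B (O i) t0))%:R%:E <= num_queries B (O i).
  by apply: ereal_sup_ubound; exists t0.
by move=> /le_lt_trans/(_ few); rewrite lte_fin ltr_nat ltnS.
Qed.

(** A success is either late or comes within [t] queries. Once [w] is fixed the strategy is
    deterministic, so early success is possible on at most [K] instances. *)
Lemma success_probability_le_tail (a : R) : (a <= t.+1%:R)%R ->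
  success_probability X O eps P A <=
  queries_tail O P A a + (K%:R / #|instance F|%:R)%:E.
Proof.
move=> at1; have [_ _ mT mS] := algA.
pose late i := [set w | a%:E <= num_queries (A w) (O i)].
have mlate i : measurable (late i).
  by rewrite -[late i]setTI; exact: emeasurable_fun_c_infty.
pose B i := [set w | success X O eps (A w) i] `\` late i.
have mB i : measurable (B i) by exact: measurableD.
have split_success : success_probability X O eps P A <=
    uniform_mean (fun i => P (late i) + P (B i)).
  apply: le_uniform_mean => i.
  have mU : P (late i `|` B i) <= P (late i) + P (B i) by exact: measureU2.
  apply: le_trans mU; apply: le_measure; rewrite ?inE//.
    exact: measurableU.
  by move=> w sw; have [lw|lw] := pselect (late i w); [left|right].
apply: (le_trans split_success); rewrite uniform_meanD//; apply: leeD => //.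
rewrite /uniform_mean mulrC EFinM; apply: lee_wpmul2l.
  by rewrite lee_fin invr_ge0.
apply: sum_probability_le => // w.
apply: leq_trans (count (A w)); apply/subset_leq_card/fintype.subsetP => i.
rewrite !finset.inE => /asboolP[sw /negP]; rewrite -ltNge => few.
apply: success_solved_within => //; apply: lt_le_trans few _.
by rewrite lee_fin.
Qed.

Lemma expected_queries_ge_tail (a : R) : (0 <= a)%R ->
  a%:E * queries_tail O P A a <= expected_queries O P A.
Proof.
move=> a0; have [_ _ mT _] := algA.
rewrite /queries_tail -uniform_meanZl//; apply: le_uniform_mean => i.
by apply: markov_ge0 => // w; exact: num_queries_ge0.
Qed.

End Tail.

(** * Asymptotics *)

Section Scales.
Variables (R : realType) (p : R).
Hypothesis p1 : 1 <= p.

Definition cube_radius n : R := n%:R `^ (- p^-1).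

(** The depth M is chosen with 16^M <= r / (4 eps), so that [eps] is at most the separation gap r
    16^(-M) / 4; the division by 4 turns binary logarithms into logarithms to base 16. *)
Definition num_levels n (eps : R) : nat :=
  Num.truncn (log2 (cube_radius n / (4 * eps)) / 4).

Let ln2_gt0 : 0 < ln 2 :> R. Proof. by rewrite ln_gt0// ltr1n. Qed.

Lemma cube_radius_gt0 n : (0 < n)%N -> 0 < cube_radius n.
Proof. by move=> n0; rewrite powR_gt0// ltr0n. Qed.

Lemma le_gap_num_levels n (eps : R) : (0 < n)%N -> 0 < eps -> (0 < num_levels n eps)%N ->
  eps <= cube_radius n * (16^-1 ^+ num_levels n eps / 4).
Proof.
move=> n0 e0; rewrite truncn_gt0 => x1.
have le_l : (num_levels n eps)%:R <= log2 (cube_radius n / (4 * eps)) / 4.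
  by rewrite truncn_le (le_trans _ x1).
move: le_l; set m := num_levels n eps; set x := _ / (4 * eps) => le_l.
have x0 : 0 < x by rewrite divr_gt0 ?cube_radius_gt0// mulr_gt0.
have h : 16 ^+ m <= x.
  rewrite -ler_ln ?posrE ?exprn_gt0// lnXn// (_ : 16 = 2 ^+ 4); last by ring.
  rewrite lnXn// -mulrnA -[leLHS]mulr_natr natrM.
  move: le_l; rewrite /log2 mulrAC ler_pdivlMr// ler_pdivlMr//.
  by apply: le_trans; rewrite le_eqVlt; apply/orP; left; apply/eqP; ring.
rewrite exprVn mulrA ler_pdivlMr// ler_pdivlMr ?exprn_gt0//.
by move: h; rewrite ler_pdivlMr ?mulr_gt0// mulrC (mulrC 4).
Qed.

(** The share of log(1/eps) left after subtracting (log n) / p, given that log n <= log(1/eps) /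
    (1/p + delta). *)
Definition rate (delta : R) : R := delta / (p^-1 + delta).

Lemma num_levels_large (delta : R) : 0 < delta -> exists N : nat, forall n eps,
  (N <= n)%N -> low_scale p delta n eps ->
  [/\ (0 < n)%N, 0 <= log2 eps^-1, (4 <= num_levels n eps)%N &
      rate delta * log2 eps^-1 <= 8 * (num_levels n eps)%:R].
Proof.
move=> d0.
(* This makes [delta * log2 n] at least 32, hence also [rate delta * log2 eps^-1], which absorbs the
   losses from the factor 4 in the gap and from rounding. *)
exists (Num.truncn (2 `^ (32 / delta) : R)).+1 => n eps Nn [e0 e_le].
have n0 : (0 < n)%N by apply: leq_trans Nn.
have nR : 0 < n%:R :> R by rewrite ltr0n.
have p0 : 0 < p by apply: lt_le_trans p1.
have pV : 0 < p^-1 by rewrite invr_gt0.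
have n_large : 32 <= delta * log2 n%:R.
  have h : (2 `^ (32 / delta) : R) <= n%:R.
    apply: (@le_trans _ _ (Num.truncn (2 `^ (32 / delta) : R)).+1%:R).
      by apply/ltW; exact: truncnS_gt.
    by rewrite ler_nat.
  move: h; rewrite -ler_ln ?posrE ?powR_gt0// ln_powR.
  rewrite -(ler_pM2l d0) /log2 mulrA ler_pdivlMr//; apply: le_trans.
  by rewrite mulrA [delta * _]mulrC mulfVK ?lt0r_neq0.
set L := log2 eps^-1; set l := log2 n%:R in n_large *.
have Ll : (p^-1 + delta) * l <= L.
  move: e_le; rewrite -ler_ln ?posrE ?powR_gt0// ln_powR.
  rewrite /L /l /log2 mulrA ler_pdivrMr// mulfVK ?lt0r_neq0// lnV ?posrE//.
  lra.
have s0 : 0 < p^-1 + delta by rewrite addr_gt0.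
have l0 : 0 <= l by rewrite /l /log2 divr_ge0 ?ln_ge0 ?ler1n// ltW.
have L0 : 0 <= L by apply: le_trans Ll; rewrite mulr_ge0// ltW.
have rateE : rate delta * (p^-1 + delta) = delta.
  by rewrite mulfVK// lt0r_neq0.
have rate0 : 0 <= rate delta by rewrite divr_ge0// ltW.
have kL : 32 <= rate delta * L.
  apply: le_trans n_large _; rewrite -[X in X * l]rateE -mulrA.
  by rewrite ler_wpM2l.
have xE : log2 (cube_radius n / (4 * eps)) = L - p^-1 * l - 2.
  rewrite /L /l /log2 ln_div ?posrE ?cube_radius_gt0 ?mulr_gt0//.
  rewrite lnM ?posrE// lnV ?posrE// ln_powR (_ : 4 = 2 ^+ 2) ?lnXn//; last by ring.
  by field; rewrite !lt0r_neq0.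
have x_ge : rate delta * L - 2 <= L - p^-1 * l - 2.
  rewrite lerD2r -subr_ge0.
  have -> : L - p^-1 * l - rate delta * L = p^-1 / (p^-1 + delta) * (L - (p^-1 + delta) * l).
    by rewrite /rate; field; rewrite !lt0r_neq0// addr_gt0// mulr_gt0.
  by rewrite mulr_ge0 ?subr_ge0// divr_ge0// ltW.
have M_gt := truncnS_gt (log2 (cube_radius n / (4 * eps)) / 4).
rewrite -/(num_levels n eps) xE -natr1 in M_gt.
have M8 : rate delta * L <= 8 * (num_levels n eps)%:R by lra.
split=> //; rewrite -(ler_nat R); lra.
Qed.

End Scales.

(** The chain is 32 a <= x (k L) <= 8 x m <= 32 T. *)
Lemma few_queries (R : realFieldType) (a k L x m T : R) :
  0 <= x -> 32 * a <= k * x * L -> k * L <= 8 * m -> x * m <= 4 * T -> a <= T.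
Proof.
move=> x0 a_le kL xm.
have : x * (k * L) <= x * (8 * m) by rewrite ler_wpM2l.
by lra.
Qed.

(* [2^t (3/4)^N = (27/32)^t (3/4)^(N - 3t)]. *)
Lemma guessed_fraction (R : realFieldType) (n N t K : nat) :
  (K * 2 ^ N <= 2 ^ t * 3 ^ N)%N -> (4 * t <= N)%N -> (4 * n <= N)%N ->
  K%:R / (2 ^ N)%:R <= (3 / 4) ^+ n :> R.
Proof.
move=> K1 tN nN.
have {}K1 : K%:R * 2 ^+ N <= 2 ^+ t * 3 ^+ N :> R by rewrite -!natrX -!natrM ler_nat.
(* Since t <= N/4, what remains after removing 3t is at least N/4 >= n. *)
have [j Nj nj] : exists2 j, (N = 3 * t + j)%N & (n <= j)%N.
  by exists (N - 3 * t)%N; lia.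
rewrite natrX ler_pdivrMr ?exprn_gt0// -(ler_pM2r (exprn_gt0 N (ltr0n R 2))) (le_trans K1)//.
have -> : 3 ^+ N = (3 / 4) ^+ N * (2 ^+ N * 2 ^+ N) :> R.
  by rewrite -!exprMn; congr (_ ^+ _); field.
rewrite -[leRHS]mulrA [leLHS]mulrA ler_pM2r ?mulr_gt0 ?exprn_gt0//.
rewrite Nj exprD mulrA exprM -exprMn.
apply: (@le_trans _ _ (1 * (3 / 4) ^+ j)).
  by rewrite ler_wpM2r ?exprn_ge0 ?exprn_ile1//; lra.
by rewrite mul1r ler_wiXn2l//; lra.
Qed.

Theorem propositionV5 (R : realType) (p : R) (hp : 1 <= p) :
  exists (F : forall n : nat, R -> family R n)
         (O : forall (n : nat) (eps : R), oracle (F n eps)),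
    (forall (n : nat) (eps delta : R),
       (0 < n)%N -> 0 < delta -> low_scale p delta n eps ->
       [/\ convex_lipschitz_family p (lp_ball p) (F n eps),
           first_order (lp_ball p) (O n eps)
         & single_coordinate (lp_ball p) (O n eps)]) /\
    (forall delta : R, 0 < delta ->
       exists2 c : R, 0 < c &
         forall Pe : R, 0 <= Pe -> Pe < 1 ->
           distributional_lower_bound p delta O c Pe /\
           high_probability_lower_bound p delta O c Pe).
Proof.
(* The family does not involve [delta] or [Pe], so one choice serves them all. *)
pose F n eps := @hard_family R n (num_levels p n eps) (cube_radius p n).
pose O n eps : oracle (F n eps) :=
  @hard_oracle R n (num_levels p n eps) (cube_radius p n) (lp_ball p).
have cube n (x : 'rV[R]_n) : (0 < n)%N -> sup_norm x <= cube_radius p n -> lp_ball p x.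
  by move=> n0; apply: lp_ball_cube.
exists F, O; split=> [n eps delta n0 _ _|delta d0].
  have r0 := cube_radius_gt0 p n0.
  split.
  - by apply: hard_family_lipschitz => // [x|x i]; [exact: cube|exact: coord_le_lp_norm].
  - exact: (@hard_first_order R n _ _ _ n0 r0 (fun x => cube n x n0) (@lp_ball_convex R p n hp)).
  - exact: (@hard_single_coordinate R n _ _ _ n0 r0 (fun x => cube n x n0) (@lp_ball_convex R p n hp)).
have k0 : 0 < rate p delta.
  by rewrite divr_gt0// addr_gt0// invr_gt0; apply: lt_le_trans hp.
have [N levels] := num_levels_large hp d0.
have tail n eps Pe d (W : measurableType d) (P : probability W R) (A : W -> strategy R n) a :
    (N <= n)%N -> low_scale p delta n eps ->
    algorithm (lp_ball p) (O n eps) eps P A ->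
    ((1 - Pe)%:E <= success_probability (lp_ball p) (O n eps) eps P A)%E ->
    32 * a <= rate p delta * n%:R * log2 eps^-1 ->
    ((1 - Pe - (3 / 4) ^+ n)%:E <= queries_tail (O n eps) P A a)%E.
  move=> Nn low algA succ a_le.
  have [n0 L0 M4 M_ge] := levels n eps Nn low.
  have [e0 _] := low.
  set M := num_levels p n eps in M4 M_ge.
  have r0 := cube_radius_gt0 p n0.
  have gap := le_gap_num_levels n0 e0 (leq_trans (isT : (0 < 4)%N) M4).
  (* A quarter of the unknown bits is the query budget, and [K] is the resulting bound on the number
     of solved instances. *)
  pose t := (n * M %/ 4)%N; pose K := ((2 ^ t * 3 ^ (n * M)) %/ 2 ^ (n * M))%N.
  have cardF : #|instance (F n eps)| = (2 ^ (n * M))%N.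
    by rewrite card_ffun card_tuple card_bool card_ord -expnM mulnC.
  have count B : (#|[set i : instance (F n eps) | solved_within (O n eps i)
      (fun x => `[< eps_minimum (lp_ball p) (objective i) eps x >]) t B]%SET| <= K)%N.
    rewrite /K leq_divRL ?expn_gt0//.
    exact: (card_hard_solved n0 r0 (fun x => cube n x n0) t B gap).
  have t_le : a <= t.+1%:R.
    apply: (few_queries (ler0n R n) a_le M_ge).
    by rewrite -!natrM ler_nat [leqRHS]mulnC ltnW// ltn_ceil.
  have := success_probability_le_tail count algA t_le.
  move=> /(le_trans succ) succ_le.
  have K_le : K%:R / #|instance (F n eps)|%:R <= (3 / 4) ^+ n :> R.
    rewrite cardF; apply: (@guessed_fraction R n (n * M) t K); first exact: leq_divM.
      by rewrite mulnC leq_divM.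
    by rewrite mulnC leq_mul2l M4 orbT.
  rewrite EFinB leeBlDr//; apply: le_trans succ_le _.
  by rewrite leeD2l// lee_fin.
(* The tail bound holds up to [rate p delta / 32]; the other factor 2 is spent in Markov's
   inequality for the expectation. *)
exists (rate p delta / 64); first by rewrite divr_gt0.
have q_cvg : ((GRing.exp (3 / 4 : R) : nat -> R) @ \oo --> (0 : R))%classic.
  by apply: cvg_expr; rewrite ger0_norm; lra.
move=> Pe Pe0 Pe1; split; last first.
  exists (GRing.exp (3 / 4)) => //.
  exists N => n eps Nn low d W P A algA succ.
  have [n0 L0 _ _] := levels n eps Nn low.
  apply: (tail n eps Pe d W P A) => //.
  have := mulr_ge0 (mulr_ge0 (ltW k0) (ler0n R n)) L0.
  by lra.
(* For large [n] the term (3/4)^n costs at most half of 1 - Pe; only the threshold on [n], not the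
   constant, depends on [Pe]. *)
have e0 : 0 < (1 - Pe) / 2 by lra.
have /cvgrPdist_le/(_ _ e0)[N1 _ q_small] := q_cvg.
exists (maxn N N1) => n eps; rewrite geq_max => /andP[Nn N1n] low d W P A algA succ.
have [n0 L0 _ _] := levels n eps Nn low.
pose a := rate p delta / 32 * n%:R * log2 eps^-1.
have a0 : 0 <= a by have := mulr_ge0 (mulr_ge0 (ltW k0) (ler0n R n)) L0; rewrite /a; lra.
apply: le_trans (expected_queries_ge_tail algA a0).
have := tail n eps Pe d W P A a Nn low algA succ.
move=> /(_ _) h; apply: (@le_trans _ _ (a%:E * (1 - Pe - (3 / 4) ^+ n)%:E)%E); last first.
  by apply: lee_wpmul2l; [rewrite lee_fin|apply: h; rewrite /a; lra].
rewrite -EFinM lee_fin.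
have := q_small n N1n; rewrite sub0r normrN ger0_norm ?exprn_ge0//.
move=> q_le; have : a * ((1 - Pe) / 2) <= a * (1 - Pe - (3 / 4) ^+ n).
  by rewrite ler_wpM2l//; lra.
by rewrite /a; lra.
Qed.
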